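(* Let $R$ be a set of requests on a bidirected tree $T$. Then $\chi(R,T)\le 2\,\omega(R,T)$.
   Context: A bidirected tree $T$ is a digraph obtained from a finite undirected tree by replacing each edge $uv$ by the two arcs $(u,v)$ and $(v,u)$. A request in $T$ is a directed path in $T$ with at least one arc. For a directed path $r$, $s_r$ is its first vertex, $t_r$ its last vertex, $s_r^+$ its second vertex, $t_r^-$ its penultimate vertex; its emission arc is $(s_r,s_r^+)$ and its reception arc is $(t_r^-,t_r)$. $T[x,y]$ denotes the unique directed path from $x$ to $y$ in $T$. A request $r$ interferes on $r'$ if $T[s_r,t_{r'}]$ has first arc the emission arc of $r$ and last arc the reception arc of $r'$; two requests interfere if one interferes on the other. $\mathcal{I}(R,T)$ is the graph on $R$ with an edge between two distinct requests iff they interfere; $\omega(R,T)$ and $\chi(R,T)$ are its clique and chromatic numbers. *)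

(* Defs.v *)
From HB Require Import structures.
From mathcomp Require Import all_boot.
From mathcomp Require Import finmap.

Set Implicit Arguments.
Unset Strict Implicit.
Unset Printing Implicit Defensive.

Record sgraph := SGraph {
  vertex :> finType;
  adj : rel vertex;
  adj_sym : symmetric adj;
  adj_irr : irreflexive adj }.

Section GraphParameters.
Variable G : sgraph.

Definition clique (A : {set G}) : bool :=
  [forall x in A, forall y in A, (x != y) ==> adj x y].

Definition clique_number : nat := \max_(A : {set G} | clique A) #|A|.

Definition colourable (k : nat) : bool :=
  [exists c : {ffun G -> 'I_k},
    [forall x, forall y, adj x y ==> (c x != c y)]].

Lemma colourable_card : exists k, colourable k.
Proof.
exists #|G|; apply/existsP; exists [ffun x => enum_rank x].
apply/forallP=> x; apply/forallP=> y; apply/implyP=> xy; rewrite !ffunE.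
by apply: contraTneq xy => /enum_rank_inj ->; rewrite adj_irr.
Qed.

Definition chromatic_number : nat := ex_minn colourable_card.

End GraphParameters.

(* [ucycle] accepts the sequence [:: u; v] for an edge uv, hence the bound:
   a graph cycle is a simple cyclic sequence of at least three vertices.
   The adjacency relation being symmetric, it is also the arc relation of the
   bidirected tree. *)
Record tree := Tree {
  tree_graph :> sgraph;
  tree_nonempty : 0 < #|tree_graph|;
  tree_connected : forall x y : tree_graph, connect (@adj tree_graph) x y;
  tree_acyclic :
    forall c : seq tree_graph, ucycle (@adj tree_graph) c -> size c < 3 }.

Section Requests.
Variable T : tree.

(* The pair (x, q) stands for the vertex sequence x :: q. *)
Definition dipath (p : T * seq T) : bool :=
  path (@adj T) p.1 p.2 && uniq (p.1 :: p.2).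

Definition arcs (p : T * seq T) : seq (T * T) := pairmap pair p.1 p.2.

Definition dipath_between (x y : T) (p : T * seq T) : bool :=
  [&& dipath p, p.1 == x & last p.1 p.2 == y].

Lemma dipath_exists (x y : T) : exists p, dipath_between x y p.
Proof.
have /connectP [q xq ->] := tree_connected x y.
case/shortenP: xq => q' xq' uq' _.
by exists (x, q'); rewrite /dipath_between /dipath xq' uq' /= !eqxx.
Qed.

(* The path T[x, y]; it is the only one from x to y since T is acyclic. *)
Definition tree_path (x y : T) : T * seq T := xchoose (dipath_exists x y).

Record request := Request {
  request_path :> T * seq T;
  requestP : dipath request_path && (0 < size (arcs request_path)) }.

HB.instance Definition _ := [isSub for request_path].
HB.instance Definition _ := [Choice of request by <:].

Definition source (r : request) : T := r.1.
Definition target (r : request) : T := last r.1 r.2.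
Definition second (r : request) : T := head r.1 r.2.
Definition penultimate (r : request) : T := nth r.1 (r.1 :: r.2) (size r.2).-1.

Definition emission_arc (r : request) : T * T := (source r, second r).
Definition reception_arc (r : request) : T * T := (penultimate r, target r).

Definition interferes_on (r r' : request) : bool :=
  let p := tree_path (source r) (target r') in
  prefix [:: emission_arc r] (arcs p) && suffix [:: reception_arc r'] (arcs p).

Definition conflict (r r' : request) : bool :=
  (r != r') && (interferes_on r r' || interferes_on r' r).

Lemma conflict_sym : symmetric conflict.
Proof. by move=> r r'; rewrite /conflict eq_sym orbC. Qed.

Lemma conflict_irr : irreflexive conflict.
Proof. by move=> r; rewrite /conflict eqxx. Qed.

Definition interference_graph (R : {fset request}) : sgraph :=
  @SGraph R (fun r r' : R => conflict (val r) (val r'))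
    (fun r r' => conflict_sym (val r) (val r'))
    (fun r => conflict_irr (val r)).

End Requests.

(* Main.v *)
Require Import Defs.
From mathcomp Require Import all_boot.
From mathcomp Require Import finmap.

(* An arc a = (x, y) is encoded by the half-tree S(a) on the side of y; there is
   a directed path with first arc a and last arc b iff S(b) is included in S(a).
   Hence a request r becomes a pair of sets B(r), A(r), the former included in
   the latter, taken from a cross-free family closed under complement; r and r'
   interfere iff B(r') is included in A(r) or B(r) in A(r').  Fix a root rho.
   Requests directed towards rho (rho in B(r)) interfere iff their sets B are
   nested, requests directed away from rho (rho not in A(r)) iff their sets A are; both graphs have a
   perfect elimination ordering.  The other requests, those through rho or
   with a turning point away from it, induce a co-bipartite graph: two of them
   that do not interfere turn at the same vertex and exchange the same two
   branches.  So these three graphs have chromatic number equal to their clique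
   number, and it suffices to find rho such that the first two clique numbers
   add up to at most omega.  If rho is bad, the maximum cliques directed towards
   rho and away from rho do not form a clique together, which confines both to
   one half-tree S avoiding rho.  Walking into a minimal such S produces one for
   which the complement of S has the same property; then the incoming clique of
   each side is joined to the outgoing clique of the other side, so the four
   sizes add up to at most 2 omega, a contradiction. *)

Set Implicit Arguments.
Unset Strict Implicit.
Unset Printing Implicit Defensive.

(** * Colourings *)

Section Colourings.
Variables (V : finType) (e : rel V).
Hypotheses (e_sym : symmetric e) (e_irr : irreflexive e).

Definition is_clique (K : {set V}) : bool :=
  [forall x in K, forall y in K, (x != y) ==> e x y].

Lemma is_cliqueP (K : {set V}) :
  reflect {in K &, forall x y, x != y -> e x y} (is_clique K).
Proof.
apply: (iffP forall_inP) => [H x y xK yK|H x xK].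
  by move/forall_inP: (H x xK) => /(_ y yK)/implyP.
by apply/forall_inP => y yK; apply/implyP; apply: H.
Qed.

Definition clique_bound (P : {set V}) (w : nat) : Prop :=
  forall K : {set V}, K \subset P -> is_clique K -> #|K| <= w.

Lemma clique_boundS (P Q : {set V}) w :
  P \subset Q -> clique_bound Q w -> clique_bound P w.
Proof. by move=> PQ Qw K KP; apply: Qw; apply: subset_trans PQ. Qed.

Lemma is_clique_joinU (K L : {set V}) : is_clique K -> is_clique L ->
  (forall x y, x \in K -> y \in L -> x != y -> e x y) -> is_clique (K :|: L).
Proof.
move=> /is_cliqueP Kcl /is_cliqueP Lcl KL; apply/is_cliqueP => x y.
rewrite !inE => /orP[xK|xL] /orP[yK|yL] xy; [exact: Kcl|exact: KL| |exact: Lcl].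
by rewrite e_sym; apply: KL => //; rewrite eq_sym.
Qed.

Definition set_colourable (P : {set V}) (k : nat) : Prop :=
  exists c : V -> nat, {in P, forall x, c x < k} /\
                       {in P &, forall x y, e x y -> c x != c y}.

Lemma set_colourableU (P Q : {set V}) k l : set_colourable P k ->
  set_colourable Q l -> set_colourable (P :|: Q) (k + l).
Proof.
move=> [c [cP cPe]] [d [dQ dQe]].
exists (fun x => if x \in P then c x else k + d x).
split=> [x|x y]; rewrite !inE.
  case: ifP => [xP _|_ /= xQ]; first by rewrite ltn_addr ?cP.
  by rewrite ltn_add2l dQ.
case: ifP => [xP _|_ /= xQ]; case: ifP => [yP _|_ /= yQ] exy.
- exact: cPe.
- by rewrite ltn_eqF // ltn_addr ?cP.
- by rewrite gtn_eqF // ltn_addr ?cP.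
- by rewrite eqn_add2l dQe.
Qed.

Lemma set_colourable_independent (P : {set V}) :
  {in P &, forall x y, ~~ e x y} -> set_colourable P 1.
Proof. by move=> Pe; exists (fun=> 0); split=> // x y /Pe xP /xP /negPf->. Qed.

(** Greedy colouring along a perfect elimination ordering: a simplicial vertex and its neighbours
    form a clique, so fewer than [w] colours are blocked for it. *)
Lemma simplicial_colourable (P : {set V}) w :
    (forall Q : {set V}, Q \subset P -> Q != set0 ->
       exists2 x, x \in Q & is_clique [set y in Q | e x y]) ->
  clique_bound P w -> set_colourable P w.
Proof.
have [n] := ubnP #|P|; elim: n P => // n IHn P leP simP Pw.
have [->|Pn0] := eqVneq P set0.
  by exists (fun=> 0); split=> [x|x y]; rewrite inE.
have [x xP xcl] := simP P (subxx _) Pn0.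
have DP : P :\ x \subset P by apply: subsetDl.
have [c [cP cPe]] : set_colourable (P :\ x) w.
  apply: IHn; last exact: clique_boundS Pw.
  - by rewrite (cardsD1 x P) xP add1n ltnS in leP.
  - by move=> Q QP; apply: simP; apply: subset_trans DP.
set Nx := [set y in P | e x y] in xcl.
have xNx : x \notin Nx by rewrite inE e_irr andbF.
have Nxw : #|Nx| < w.
  have : #|x |: Nx| <= w.
    apply: Pw.
      by apply/subsetP => y; rewrite !inE => /orP[/eqP->|/andP[]].
    apply/is_cliqueP => y z; rewrite !in_setU1.
    move=> /orP[/eqP->|yN] /orP[/eqP->|zN]; rewrite ?eqxx // => yz.
    - by move: zN; rewrite inE => /andP[].
    - by move: yN; rewrite inE e_sym => /andP[].
    - by move/is_cliqueP: xcl; apply.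
  by rewrite cardsU1 xNx.
have [k kw kN] : exists2 k, k < w & k \notin map c (enum Nx).
  have [/hasP[k]|/hasPn H] :=
      boolP (has (fun k => k \notin map c (enum Nx)) (iota 0 w)).
    by rewrite mem_iota add0n => ? ?; exists k.
  have sub : {subset iota 0 w <= map c (enum Nx)} by move=> k /H; rewrite negbK.
  suff : w <= #|Nx| by rewrite leqNgt Nxw.
  by have := uniq_leq_size (iota_uniq 0 w) sub; rewrite size_iota size_map -cardE.
have fresh y : y \in P -> e x y -> k != c y.
  move=> yP exy; apply: contraNneq kN => ->.
  by apply: map_f; rewrite mem_enum inE yP.
exists (fun y => if y == x then k else c y); split=> [y yP|y z yP zP].
  by case: eqP => // /eqP yx; apply: cP; rewrite !inE yx.
case: (eqVneq y x) => [->|yx]; case: (eqVneq z x) => [->|zx].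
- by rewrite e_irr.
- exact: fresh.
- by rewrite e_sym eq_sym; apply: fresh.
- by apply: cPe; rewrite !inE ?yx ?zx.
Qed.

Section Cobipartite.
Variables (side : V -> bool) (P : {set V}).
Hypothesis side_clique :
  {in P &, forall x y, x != y -> side x = side y -> e x y}.

(* Maximum cliques of a co-bipartite graph are closed under taking the union
   on one side and the intersection on the other. *)
Lemma cobipartite_merge (b : bool) (K L : {set V}) w : clique_bound P w ->
    K \subset P -> L \subset P -> is_clique K -> is_clique L ->
    #|K| = w -> #|L| = w ->
  exists H : {set V}, [/\ H \subset P, is_clique H, #|H| = w &
    forall x, (x \in H) =
      if side x == b then (x \in K) || (x \in L) else (x \in K) && (x \in L)].
Proof.
move=> Pw KP LP Kcl Lcl Kw Lw.
pose mix b := [set x | if side x == b then (x \in K) || (x \in L)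
                       else (x \in K) && (x \in L)].
have mixP b' : mix b' \subset P.
  apply/subsetP => x; rewrite inE => xm; have : (x \in K) || (x \in L).
    by move: xm; case: ifP => // _ /andP[->].
  by case/orP; apply/subsetP.
have mixcl b' : is_clique (mix b').
  apply/is_cliqueP => x y xm ym xy.
  have xP := subsetP (mixP b') x xm; have yP := subsetP (mixP b') y ym.
  have [sxy|sxy] := eqVneq (side x) (side y); first exact: side_clique.
  move: xm ym; rewrite !inE.
  have both : forall z t, z != t -> (z \in K) || (z \in L) ->
      (t \in K) && (t \in L) -> e z t.
    move=> z t zt /orP[zK|zL] /andP[tK tL].
    - by move/is_cliqueP: Kcl; apply.
    - by move/is_cliqueP: Lcl; apply.
  case: ifP => [/eqP sx|sx]; case: ifP => [/eqP sy|sy].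
  - by rewrite sx sy eqxx in sxy.
  - by move=> xo ya; apply: both.
  - by move=> xa yo; rewrite e_sym; apply: both => //; rewrite eq_sym.
  - by move: sxy sx sy; case: (side x) (side y) b' => [] [] [].
have mixw b' : #|mix b'| <= w by exact: Pw.
have negE c : (c == ~~ b) = ~~ (c == b) by move: c b => [] [].
pose Y := [set x | side x == b].
have mixE : mix b = (K :|: L) :&: Y :|: (K :&: L) :\: Y.
  by apply/setP => x; rewrite !inE; case: (side x == b); rewrite ?andbT ?andbF ?orbF.
have mixN : mix (~~ b) = (K :&: L) :&: Y :|: (K :|: L) :\: Y.
  apply/setP => x; rewrite !inE.
  rewrite negE.
  by case: (side x == b); rewrite /= ?andbT ?andbF ?orbF.
have cU (S S' : {set V}) : #|S :&: Y :|: S' :\: Y| = #|S :&: Y| + #|S' :\: Y|.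
  rewrite cardsU; have -> : (S :&: Y) :&: (S' :\: Y) = set0.
    by apply/setP => x; rewrite !inE; case: (side x == b); rewrite ?andbF.
  by rewrite cards0 subn0.
(* The two mixtures cover each vertex as often as [K] and [L] do. Neither exceeds [w], so both have
   size [w]. *)
have mix2 : #|mix b| + #|mix (~~ b)| = w + w.
  have <- : #|K :|: L| + #|K :&: L| = w + w by rewrite cardsUI Kw Lw.
  rewrite mixE mixN !cU -(cardsID Y (K :|: L)) -(cardsID Y (K :&: L)).
  by rewrite addnACA [in RHS]addnACA [in RHS](addnC #|_ :\: Y|).
exists (mix b); split=> // [|x]; last by rewrite inE.
apply/eqP; rewrite eqn_leq mixw /= -(leq_add2r w) -mix2 leq_add2l; exact: mixw.
Qed.

End Cobipartite.

(* König's theorem, stated in the complement. *)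
Lemma cobipartite_colourable (side : V -> bool) (P : {set V}) w :
    {in P &, forall x y, x != y -> side x = side y -> e x y} ->
  clique_bound P w -> set_colourable P w.
Proof.
elim: w P => [|w IHw] P sideP Pw.
  suff -> : P = set0 by exists (fun=> 0); split=> [x|x y]; rewrite inE.
  apply/setP => x; rewrite inE; apply/negP => xP.
  suff : #|[set x]| <= 0 by rewrite cards1.
  apply: Pw; first by rewrite sub1set.
  by apply/is_cliqueP => y z; rewrite !inE => /eqP-> /eqP->; rewrite eqxx.
have [->|[y yP]] := set_0Vmem P.
  by exists (fun=> 0); split=> [x|x y]; rewrite inE.
pose full (K : {set V}) := [&& K \subset P, is_clique K & #|K| == w.+1].
(* If some [x] not adjacent to [y] (possibly [y] itself) makes [[set x; y]] hit every clique of size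
   [w.+1], this pair becomes a colour class and the rest is coloured by induction. *)
have [/existsP[x /and3P[xP xy /forallP hit]]|nohit] := boolP [exists x, [&& x \in P,
    ~~ e x y & [forall K : {set V}, full K ==> (x \in K) || (y \in K)]]].
  have -> : P = (P :\: [set x; y]) :|: [set x; y].
    apply/setP => z; rewrite !inE.
    by do 2![case: eqP => [->|_] //=; rewrite ?xP ?yP //]; rewrite orbF.
  rewrite -addn1; apply: set_colourableU; last first.
    apply: set_colourable_independent => z t; rewrite !inE.
    by move=> /orP[]/eqP-> /orP[]/eqP->; rewrite ?e_irr // e_sym.
  have DP : P :\: [set x; y] \subset P by apply: subsetDl.
  apply: IHw => [z t /(subsetP DP) zP /(subsetP DP)|K KD Kcl]; first exact: sideP.
  have := Pw K (subset_trans KD DP) Kcl; rewrite leq_eqVlt ltnS => /orP[Kw|//].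
  have := hit K; rewrite /full (subset_trans KD DP) Kcl Kw /=.
  by move=> /orP[] /(subsetP KD); rewrite !inE eqxx ?orbT.
have avoid0 x : x \in P -> ~~ e x y ->
    exists K : {set V}, [/\ full K, x \notin K & y \notin K].
  move=> xP xy; move: nohit; rewrite negb_exists => /forallP/(_ x).
  rewrite xP xy /= negb_forall => /existsP[K]; rewrite negb_imply negb_or.
  by case/and3P=> *; exists K.
(* A clique of size [w.+1] avoiding [y] and all its non-neighbours could be enlarged by [y]. *)
suff [K [/and3P[KP Kcl /eqP Kw] yK KN]] : exists K : {set V},
    [/\ full K, y \notin K & forall x, x \in enum [set x in P | ~~ e x y] -> x \notin K].
  have : #|y |: K| <= w.+1.
    apply: Pw; first by apply/subsetP => z; rewrite !inE => /orP[/eqP->|/(subsetP KP)].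
    apply: is_clique_joinU => //.
      by apply/is_cliqueP => z t; rewrite !inE => /eqP-> /eqP->; rewrite eqxx.
    move=> _ z /set1P-> zK _; have zP := subsetP KP z zK.
    rewrite e_sym; apply: contraLR zK => zy; apply: KN.
    by rewrite mem_enum inE zP zy.
  by rewrite cardsU1 yK Kw add1n ltnn.
have avoid x : x \in enum [set x in P | ~~ e x y] ->
    exists K : {set V}, [/\ full K, x \notin K & y \notin K].
  by rewrite mem_enum inE => /andP[]; apply: avoid0.
have sameP x : x \in enum [set x in P | ~~ e x y] -> x != y -> side x != side y.
  rewrite mem_enum inE => /andP[xP exy] xy; apply: contraNneq exy.
  exact: sideP.
(* The cliques avoiding the single non-neighbours are merged one by one. Non-neighbours other than
   [y] lie on the side opposite to [y], where merging intersects, so once avoided they stay avoided;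
   [y] lies in none of the cliques. *)
elim: (enum _) avoid sameP => [|x s IHs] avoid sameP.
  have [|K] := avoid0 y yP; first by rewrite e_irr.
  by case=> *; exists K.
have [||K [/and3P[KP Kcl /eqP Kw] yK KN]] := IHs.
- by move=> z zs; apply: avoid; rewrite inE zs orbT.
- by move=> z zs; apply: sameP; rewrite inE zs orbT.
have [|L [/and3P[LP Lcl /eqP Lw] xL yL]] := avoid x; first by rewrite inE eqxx.
have [H [HP Hcl Hw HE]] :=
  cobipartite_merge sideP (side y) Pw KP LP Kcl Lcl Kw Lw.
exists H; split; first by rewrite /full HP Hcl Hw eqxx.
  by rewrite HE eqxx negb_or yK.
move=> z zs; rewrite HE; have [->|zy] := eqVneq z y.
  by rewrite eqxx negb_or yK.
rewrite (negPf (sameP z zs zy)) negb_and; move: zs.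
by rewrite inE => /orP[/eqP->|/KN->//]; rewrite xL orbT.
Qed.

End Colourings.

(** * Pairs of sets in a cross-free family *)

Section CrossFree.
Variables (N R : finType) (F : {set {set N}}) (A B : R -> {set N}).
Hypothesis F_compl : forall X, X \in F -> ~: X \in F.
Hypothesis F_cross : forall X Y, X \in F -> Y \in F ->
  [|| X \subset Y, Y \subset X, X \subset ~: Y | ~: Y \subset X].
(* Every member of F borders a node of the underlying tree. *)
Hypothesis F_node : forall X, X \in F ->
  exists2 q, q \in X & forall Z, Z \in F -> Z \proper X -> q \notin Z.
Hypothesis AF : forall r, A r \in F.
Hypothesis BF : forall r, B r \in F.
Hypothesis BA : forall r, B r \proper A r.

Definition meets (r r' : R) : bool :=
  (r != r') && ((B r' \subset A r) || (B r \subset A r')).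

Lemma meets_sym : symmetric meets.
Proof. by move=> r r'; rewrite /meets eq_sym orbC. Qed.

Lemma meets_irr : irreflexive meets.
Proof. by move=> r; rewrite /meets eqxx. Qed.

Let subBA r x : x \in B r -> x \in A r.
Proof. by apply/subsetP/proper_sub. Qed.

Let F_mem X : X \in F -> exists z, z \in X.
Proof. by case/F_node => z zX _; exists z. Qed.

Let F_notin X : X \in F -> exists z, z \notin X.
Proof. by case/F_compl/F_mem => z; rewrite inE; exists z. Qed.

(** [z] excludes that the two sets are disjoint, [rho] that they cover [N]. *)
Lemma laminar (rho z : N) X Y : X \in F -> Y \in F -> rho \notin X ->
  rho \notin Y -> z \in X -> z \in Y -> (X \subset Y) || (Y \subset X).
Proof.
move=> XF YF rX rY zX zY; case/or4P: (F_cross XF YF) => [->|->|/subsetP XY|/subsetP XY].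
- by [].
- by rewrite orbT.
- by have := XY z zX; rewrite inE zY.
- by have := XY rho; rewrite inE (negPf rX) => /(_ rY).
Qed.

Lemma colaminar (rho z : N) X Y : X \in F -> Y \in F -> rho \in X ->
  rho \in Y -> z \notin X -> z \notin Y -> (X \subset Y) || (Y \subset X).
Proof.
move=> XF YF rX rY zX zY; rewrite -[X \subset Y]setCS -[Y \subset X]setCS orbC.
by apply: (@laminar rho z); rewrite ?inE ?rX ?rY ?F_compl.
Qed.

(** * Requests seen from a root *)

Definition incoming (rho : N) := [set r | rho \in B r].
Definition outgoing (rho : N) := [set r | rho \notin A r].
Definition through (rho : N) := [set r | (rho \in A r) && (rho \notin B r)].

Lemma nested_meets r r' : r != r' ->
  (B r \subset B r') || (B r' \subset B r) -> meets r r'.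
Proof.
rewrite /meets => -> /orP[] H; apply/orP; [right|left];
  exact: subset_trans H (proper_sub (BA _)).
Qed.

Lemma nested_meetsA r r' : r != r' ->
  (A r \subset A r') || (A r' \subset A r) -> meets r r'.
Proof.
rewrite /meets => -> /orP[] H; apply/orP; [right|left];
  exact: subset_trans (proper_sub (BA _)) H.
Qed.

(** If the requests meet, one set [A] contains both sets [B], so these miss a common point; they
    also share [rho]. *)
Lemma incoming_nested rho r r' : r \in incoming rho -> r' \in incoming rho ->
  meets r r' -> (B r \subset B r') || (B r' \subset B r).
Proof.
rewrite !inE => rB r'B /andP[_ /orP[]/subsetP H].
  have [z zA] := F_notin (AF r); apply: (@colaminar rho z) => //.
    by apply: contra zA; apply: subBA.
  by apply: contra zA; apply: H.
have [z zA] := F_notin (AF r'); apply: (@colaminar rho z) => //.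
  by apply: contra zA; apply: H.
by apply: contra zA; apply: subBA.
Qed.

(** If the requests meet, one set [B] lies in both sets [A], which both miss [rho]. *)
Lemma outgoing_nested rho r r' : r \in outgoing rho -> r' \in outgoing rho ->
  meets r r' -> (A r \subset A r') || (A r' \subset A r).
Proof.
rewrite !inE => rA r'A /andP[_ /orP[]/subsetP H].
  have [z zB] := F_mem (BF r'); apply: (@laminar rho z) => //; first exact: H.
  exact: subBA.
have [z zB] := F_mem (BF r); apply: (@laminar rho z) => //; last exact: H.
exact: subBA.
Qed.

(** A request [x] with [B x] largest is simplicial: the sets [B] of its neighbours lie inside [B x]
    and contain [rho], hence are nested. *)
Lemma incoming_colourable rho w : clique_bound meets (incoming rho) w ->
  set_colourable meets (incoming rho) w.
Proof.
move=> Rw; apply: (simplicial_colourable meets_sym meets_irr _ Rw) => Q QP /set0Pn[x0 x0Q].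
case: (@arg_maxnP _ x0 (mem Q) (fun r => #|B r|) x0Q) => x xQ xmax.
have QI r : r \in Q -> r \in incoming rho by apply/subsetP.
have nbr r : r \in Q -> meets x r -> B r \subset B x.
  move=> rQ /(incoming_nested (QI x xQ) (QI r rQ))/orP[] // sub.
  have /eqP-> // : B r == B x by rewrite eq_sym eqEcard sub; apply: xmax.
exists x => //; apply/is_cliqueP => r r'; rewrite !inE => /andP[rQ xr].
move=> /andP[r'Q xr'] rr'; apply: nested_meets => //.
have [z zB] := F_notin (BF x); apply: (@colaminar rho z) => //.
- by move: (QI r rQ); rewrite inE.
- by move: (QI r' r'Q); rewrite inE.
- by apply: contra zB; apply/subsetP/nbr.
- by apply: contra zB; apply/subsetP/nbr.
Qed.

(** Dually, a request with smallest [A] is simplicial. *)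
Lemma outgoing_colourable rho w : clique_bound meets (outgoing rho) w ->
  set_colourable meets (outgoing rho) w.
Proof.
move=> Rw; apply: (simplicial_colourable meets_sym meets_irr _ Rw) => Q QP /set0Pn[x0 x0Q].
case: (@arg_minnP _ x0 (mem Q) (fun r => #|A r|) x0Q) => x xQ xmin.
have QI r : r \in Q -> r \in outgoing rho by apply/subsetP.
have nbr r : r \in Q -> meets x r -> A x \subset A r.
  move=> rQ /(outgoing_nested (QI x xQ) (QI r rQ))/orP[] // sub.
  have /eqP-> // : A r == A x by rewrite eqEcard sub; apply: xmin.
exists x => //; apply/is_cliqueP => r r'; rewrite !inE => /andP[rQ xr].
move=> /andP[r'Q xr'] rr'; apply: nested_meetsA => //.
have [z zB] := F_mem (AF x); apply: (@laminar rho z) => //.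
- by move: (QI r rQ); rewrite inE.
- by move: (QI r' r'Q); rewrite inE.
- by apply: subsetP zB; apply: nbr.
- by apply: subsetP zB; apply: nbr.
Qed.

(* The branch, seen from the turning point of a request through [rho], that
   contains [P] and not [Q]. *)
Definition branch (rho : N) (P Q : {set N}) : {set N} :=
  \bigcup_(Z in F | [&& rho \notin Z, Z :&: P != set0 & Z :&: Q == set0]) Z.

(** Applied to [~: A r], [B r] and the same sets of a request not meeting [r], this gives one of the
    inclusions identifying their branches. [P] and [P'] are disjoint, as nesting would violate one
    of the two disjointness hypotheses. Each [Z] in the left union is comparable with [P], and the
    larger of the two occurs in the right union. *)
Lemma branch_sub rho P Q P' Q' : P \in F -> Q \in F -> P' \in F -> Q' \in F ->
    rho \notin P -> rho \notin Q -> rho \notin P' -> rho \notin Q' ->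
    P :&: Q = set0 -> P' :&: Q' = set0 -> P :&: Q' != set0 -> P' :&: Q != set0 ->
  branch rho P Q \subset branch rho Q' P'.
Proof.
move=> PF QF P'F Q'F rP rQ rP' rQ' PQ PQ' /set0Pn[p /setIP[pP pQ']].
move=> /set0Pn[q /setIP[qP' qQ]].
have disj (X Y : {set N}) z : X :&: Y = set0 -> z \in X -> z \in Y -> False.
  by move=> XY zX zY; have := in_set0 z; rewrite -XY inE zX zY.
have PP' : P :&: P' == set0.
  apply: contraT => /set0Pn[z /setIP[zP zP']].
  case/orP: (laminar PF P'F rP rP' zP zP') => /subsetP sub.
    by case: (disj _ _ p PQ') => //; apply: sub.
  by case: (disj _ _ q PQ) => //; apply: sub.
apply/bigcupsP => Z /and4P[ZF rZ /set0Pn[z /setIP[zZ zP]] /eqP ZQ].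
case/orP: (laminar ZF PF rZ rP zZ zP) => sub.
  apply: subset_trans sub _; apply: (bigcup_max P) => //.
  rewrite PF rP PP' andbT; apply/set0Pn; exists p; exact/setIP.
apply: (bigcup_max Z) => //; rewrite ZF rZ /=; apply/andP; split.
  by apply/set0Pn; exists p; rewrite inE pQ' (subsetP sub).
apply: contraT => /set0Pn[t /setIP[tZ tP']].
case/orP: (laminar ZF P'F rZ rP' tZ tP') => /subsetP sub'.
  by case: (disj _ _ p PQ') => //; apply/sub'/(subsetP sub).
by case: (disj _ _ q ZQ) => //; apply: sub'.
Qed.

(* Two requests through [rho] that do not meet turn at the same vertex and
   exchange the same two branches. *)
Lemma through_colourable rho w : clique_bound meets (through rho) w ->
  set_colourable meets (through rho) w.
Proof.
pose c r := branch rho (~: A r) (B r); pose d r := branch rho (B r) (~: A r).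
have AB r : ~: A r :&: B r = set0.
  apply/setP => z; rewrite !inE; apply/negP => /andP[/negP zA /subBA]; exact: zA.
have cd r : r \in through rho -> c r != d r.
  rewrite inE => /andP[rA rB]; have [z zA] := F_mem (F_compl (AF r)).
  apply/eqP => /setP/(_ z); suff -> : z \in c r.
    move/esym/bigcupP => [Z /and4P[_ _ _ /eqP/setP/(_ z)]].
    by rewrite !inE => + zZ; rewrite zZ -in_setC zA.
  apply/bigcupP; exists (~: A r) => //.
  rewrite F_compl // inE rA AB setIid eqxx andbT; apply/set0Pn; by exists z.
(* The side tells which of the two distinct branches has the smaller rank; requests that do not meet
   swap [c] and [d], hence have different sides. *)
move=> Rw; apply: (cobipartite_colourable meets_sym meets_irr _ Rw
  (side := fun r => enum_rank (c r) < enum_rank (d r))).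
move=> r r' rT r'T rr'; apply: contra_eqT => nm.
have [crd drc] : c r = d r' /\ d r = c r'.
  move: rT r'T nm; rewrite !inE /meets rr' /= => /andP[rA rB] /andP[r'A r'B].
  rewrite negb_or => /andP[n1 n2].
  have n1' : ~: A r :&: B r' != set0.
    by apply: contra n1; rewrite setIC setI_eq0 disjoints_subset setCK.
  have n2' : ~: A r' :&: B r != set0.
    by apply: contra n2; rewrite setIC setI_eq0 disjoints_subset setCK.
  by split; apply/eqP; rewrite eqEsubset !branch_sub //;
     rewrite ?inE ?rA ?r'A ?F_compl //;
     rewrite ?AB // setIC ?AB // setIC.
rewrite -crd -drc; have := cd r rT; rewrite -(inj_eq enum_rank_inj) neq_ltn.
by case: ltngtP.
Qed.

(** For every root outside [S], [C] is incoming and [C'] outgoing; the property itself no longer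
    mentions a root. *)
Definition points_into (w : nat) (S : {set N}) : Prop :=
  exists C C' : {set R}, [/\ is_clique meets C, is_clique meets C',
    w < #|C| + #|C'|, {in C, forall u, ~: B u \subset S} &
    {in C', forall d, A d \subset S}].

(** The union of [C] and [C'] is too large for a clique, so some [B d] is not inside [A u], and then
    [A d] and [~: B u] share a point. A largest member [S] of [F] that contains [A d] and avoids
    [rho] absorbs every member avoiding [rho] that it meets: first [~: B u], then, by nestedness
    within each clique, all the others. *)
Lemma bad_root_points rho w (C C' : {set R}) :
    clique_bound meets setT w -> C \subset incoming rho ->
    C' \subset outgoing rho -> is_clique meets C -> is_clique meets C' ->
    w < #|C| + #|C'| ->
  exists2 S, S \in F & rho \notin S /\ points_into w S.
Proof.
move=> Rw /subsetP CI /subsetP C'O Ccl C'cl wC.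
have [/existsP[u /andP[uC /existsP[d /andP[dC' nud]]]]|nex] :=
  boolP [exists u in C, exists d in C', ~~ (B d \subset A u)]; last first.
  suff : #|C :|: C'| <= w.
    have -> : #|C :|: C'| = #|C| + #|C'|; last by rewrite leqNgt wC.
    rewrite cardsU; have -> : C :&: C' = set0; last by rewrite cards0 subn0.
    apply/setP => r; rewrite !inE; apply/negP => /andP[/CI + /C'O].
    by rewrite !inE => /subBA ->.
  apply: Rw; first exact: subsetT.
  apply: (is_clique_joinU meets_sym Ccl C'cl) => u d uC dC' ud.
  rewrite /meets ud; apply/orP; left; apply: contraR nex => nud.
  by apply/exists_inP; exists u => //; apply/exists_inP; exists d.
have [z zd zu] := subsetPn nud.
have rd : rho \notin A d by move: (C'O d dC'); rewrite inE.
have AdP : [&& A d \in F, rho \notin A d & A d \subset A d].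
  by rewrite AF rd subxx.
case: (@arg_maxnP _ (A d) (fun S => [&& S \in F, rho \notin S & A d \subset S])
        (fun S => #|S|) AdP) => S /and3P[SF rS dS] Smax.
have zS : z \in S by apply/(subsetP dS)/subBA.
have absorb X t : X \in F -> rho \notin X -> t \in X -> t \in S -> X \subset S.
  move=> XF rX tX tS; case/orP: (laminar XF SF rX rS tX tS) => // SX.
  suff /eqP<- : S == X by [].
  by rewrite eqEcard SX; apply: Smax; rewrite XF rX (subset_trans dS).
have BuS : ~: B u \subset S.
  apply: (absorb _ z) => //; rewrite ?F_compl // inE ?negbK.
    by move: (CI u uC); rewrite inE.
  by apply: contra zu; apply: subBA.
exists S => //; split=> //; exists C, C'; split=> // [u' u'C|d' d'C'].
  have [->//|uu'] := eqVneq u' u.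
  have m : meets u' u by move/is_cliqueP: Ccl; apply.
  have ru' := CI _ u'C; have nest := incoming_nested ru' (CI _ uC) m.
  have [t tu tu'] : exists2 t, t \notin B u & t \notin B u'.
    case/orP: nest => /subsetP sub.
      have [t tB] := F_notin (BF u); exists t => //; by apply: contra tB; apply: sub.
    have [t tB] := F_notin (BF u'); exists t => //; by apply: contra tB; apply: sub.
  apply: (absorb _ t); rewrite ?F_compl // ?inE ?negbK //.
    by move: ru'; rewrite inE.
  by apply: (subsetP BuS); rewrite inE.
have [->//|dd'] := eqVneq d' d.
have m : meets d' d by move/is_cliqueP: C'cl; apply.
have rd' := C'O _ d'C'; have nest := outgoing_nested rd' (C'O _ dC') m.
have rAd' : rho \notin A d' by move: rd'; rewrite inE.
case/orP: nest => /subsetP sub.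
  have [t tA] := F_mem (AF d'); apply: (absorb _ t) => //.
  by apply/(subsetP dS)/sub.
have [t tA] := F_mem (AF d); apply: (absorb _ t) => //; first exact: sub.
exact: (subsetP dS).
Qed.

Lemma points_into_compl w S : clique_bound meets setT w ->
  points_into w S -> points_into w (~: S) -> False.
Proof.
move=> Rw [C1 [D1 [C1cl D1cl w1 C1S D1S]]] [C2 [D2 [C2cl D2cl w2 C2S D2S]]].
have join (S' : {set N}) (C D : {set R}) : is_clique meets C -> is_clique meets D ->
    {in C, forall u, ~: B u \subset S'} -> {in D, forall d, A d \subset ~: S'} ->
    #|C| + #|D| <= w.
  move=> Ccl Dcl CS DS.
  (* The set [~: S'] lies between [A d] and [B u]. A request in both cliques would have [A r] inside
     [B r], against [BA], so the sizes add up. *)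
  have sub u d : u \in C -> d \in D -> A d \subset B u.
    move=> uC dD; apply: subset_trans (DS d dD) _.
    by rewrite -setCS setCK; apply: CS.
  have -> : #|C| + #|D| = #|C :|: D|.
    rewrite cardsU; have -> : C :&: D = set0; last by rewrite cards0 subn0.
    apply/setP => r; rewrite !inE; apply/negP => /andP[rC rD].
    by have := BA r; rewrite properE (sub r r) ?andbF.
  apply: Rw; first exact: subsetT.
  apply: (is_clique_joinU meets_sym Ccl Dcl) => u d uC dD ud.
  rewrite /meets ud (subset_trans (proper_sub (BA d))) //.
  exact: subset_trans (sub u d uC dD) (proper_sub (BA u)).
have j12 : #|C1| + #|D2| <= w by apply: (join S).
have j21 : #|C2| + #|D1| <= w 
  by apply: (join (~: S)) => // d /D1S; rewrite setCK.
have : w + w < #|C1| + #|D1| + (#|C2| + #|D2|).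
  by rewrite -addSn leq_add // ltnW.
by rewrite [#|C2| + _]addnC addnACA [#|D1| + _]addnC ltnNge leq_add.
Qed.

Lemma good_root (w : nat) : N -> clique_bound meets setT w ->
  exists rho, forall C C' : {set R}, C \subset incoming rho ->
    C' \subset outgoing rho -> is_clique meets C -> is_clique meets C' ->
    #|C| + #|C'| <= w.
Proof.
move=> rho0 Rw.
pose bad rho := [exists C : {set R}, exists C' : {set R},
  [&& C \subset incoming rho, C' \subset outgoing rho, is_clique meets C,
      is_clique meets C' & w < #|C| + #|C'|]].
have [/existsP[rho good]|allbad] := boolP [exists rho, ~~ bad rho].
  exists rho => C C' CI C'O Ccl C'cl; rewrite leqNgt; apply: contra good => wC.
  by apply/existsP; exists C; apply/existsP; exists C'; apply/and5P.
have points rho : exists2 S, S \in F & rho \notin S /\ points_into w S.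
  move: allbad; rewrite negb_exists => /forallP/(_ rho); rewrite negbK.
  case/existsP=> C /existsP[C' /and5P[CI C'O Ccl C'cl wC]].
  exact: bad_root_points wC.
exfalso.
have [S0 S0F [_ S0p]] := points rho0.
have [n] := ubnP #|S0|; elim: n S0 S0F S0p => // n IHn S SF Sp leS.
have [q qS qmin] := F_node SF; have [S' S'F [qS' S'p]] := points q.
have nSS' : ~~ (S \subset S') by apply: contra qS' => /subsetP; apply.
(* The node [q] lies in [S] but not in [S']. This excludes the first case and makes the inclusion
   proper in the second, where induction applies. In the third, [S' \subset ~: S] transfers the
   property to [~: S]. In the fourth, [~: S'] contains [q], so by the choice of [q] it is not a
   proper part of [S] and equals [S]. *)
case/or4P: (F_cross SF S'F) => [SS'|S'S|SS'|S'S].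
- by rewrite SS' in nSS'.
- apply: (IHn S') => //; rewrite ltnS in leS.
  by apply: leq_trans leS; rewrite proper_card // properE S'S.
- apply: points_into_compl Rw Sp _; case: S'p => C [C' [? ? ? CS C'S]].
  have sub : S' \subset ~: S by rewrite -setCS setCK.
  by exists C, C'; split=> // [u /CS|d /C'S] H; apply: subset_trans sub.
- have [eq|neq] := eqVneq (~: S') S.
    by apply: points_into_compl Rw S'p _; rewrite eq.
  have : q \notin ~: S'; last by rewrite inE qS'.
  by apply: qmin; rewrite ?F_compl // properEneq neq.
Qed.

Lemma max_clique (P : {set R}) : exists C : {set R},
  [/\ C \subset P, is_clique meets C & clique_bound meets P #|C|].
Proof.
have P0 : (set0 \subset P) && is_clique meets set0.
  by rewrite sub0set; apply/is_cliqueP => x y; rewrite inE.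
case: (@arg_maxnP _ set0 (fun C : {set R} => (C \subset P) && is_clique meets C)
  (fun C : {set R} => #|C|) P0) => C /andP[CP Ccl] Cmax.
by exists C; split=> // K KP Kcl; apply: Cmax; rewrite KP.
Qed.

(** At a good root the incoming and outgoing requests together need at most [w] colours; those
    through the root take [w] more. *)
Lemma cross_free_colourable (w : nat) : N -> clique_bound meets setT w ->
  set_colourable meets setT (2 * w).
Proof.
move=> rho0 Rw; have [rho good] := good_root rho0 Rw.
have [C [CI Ccl /incoming_colourable colC]] := max_clique (incoming rho).
have [C' [C'O C'cl /outgoing_colourable colC']] := max_clique (outgoing rho).
have colM := through_colourable (clique_boundS (subsetT (through rho)) Rw).
have [c [cP ce]] := set_colourableU (set_colourableU colC colC') colM.
exists c; split=> [r _|r r' _ _].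
  apply: leq_trans (cP r _) _; last by rewrite mul2n -addnn leq_add2r good.
  by rewrite !inE; case: (rho \in A r) (rho \in B r) => [] [].
apply: ce; rewrite !inE.
  by case: (rho \in A r) (rho \in B r) => [] [].
by case: (rho \in A r') (rho \in B r') => [] [].
Qed.

End CrossFree.

(** * Half-trees *)

Section HalfTrees.
Variable T : tree.
Notation e := (@adj T).

Definition cut (x y : T) : rel T :=
  fun u v => [&& e u v, (u, v) != (x, y) & (u, v) != (y, x)].

Definition half_tree (x y : T) : {set T} :=
  locked [set z | connect (cut x y) y z].

Lemma mem_half_tree x y z : (z \in half_tree x y) = connect (cut x y) y z.
Proof. by rewrite /half_tree -lock inE. Qed.

Lemma cut_sym x y : symmetric (cut x y).
Proof.
move=> u v; rewrite /cut adj_sym !xpair_eqE; congr (_ && _).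
by rewrite andbC [(v == x) && _]andbC [(v == y) && _]andbC.
Qed.

Lemma cutC x y : cut x y =2 cut y x.
Proof. by move=> u v; rewrite /cut; congr (_ && _); rewrite andbC. Qed.

Lemma half_tree_id x y : y \in half_tree x y.
Proof. by rewrite mem_half_tree. Qed.

(** A simple path from [y] to [x] in the cut graph closes up with the edge [xy]. Acyclicity leaves
    only a loop or the removed edge itself. *)
Lemma half_tree_out x y : e x y -> x \notin half_tree x y.
Proof.
move=> xy; rewrite mem_half_tree; apply/negP => /connectP[p yp xl].
case/shortenP: yp xl => q yq uq _ xl.
have yq' : path e y q by apply: sub_path yq => u v /and3P[].
have := @tree_acyclic T (y :: q).
rewrite /ucycle /= rcons_path yq' -xl xy -/(uniq (y :: q)) uq => /(_ isT).
case: q xl yq {uq yq'} => [|t [|]] //= xl; first by rewrite xl adj_irr in xy.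
by rewrite -xl /cut eqxx !andbF.
Qed.

(** Every edge other than [xy] survives the cut, so its ends lie on the same side. *)
Lemma half_tree_enter x y u v : e u v -> u \notin half_tree x y -> v \in half_tree x y ->
  (u, v) = (x, y).
Proof.
move=> uv uS vS; have [//|ne] := eqVneq (u, v) (x, y).
have [[eu ev]|ne'] := eqVneq (u, v) (y, x).
  by rewrite eu half_tree_id in uS.
case/negP: uS; move: vS; rewrite !mem_half_tree => /connect_trans; apply.
by apply: connect1; rewrite cut_sym /cut uv ne.
Qed.

Lemma half_tree_closed (S : {set T}) : 
  (forall u v, u \in S -> e u v -> v \in S) -> S != set0 -> S = setT.
Proof.
move=> Scl /set0Pn[x xS]; apply/setP => z; rewrite inE.
have /connectP[p xp ->] := tree_connected x z.
by elim: p x xS xp => //= y p IHp x xS /andP[xy]; apply/IHp/(Scl x).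
Qed.

(** A common vertex would link [y] to [x] in the cut graph. The union of both sides is closed under
    adjacency, since either side is left only along [xy]. *)
Lemma half_treeC x y : e x y -> half_tree y x = ~: half_tree x y.
Proof.
move=> xy; have yx : e y x by rewrite adj_sym.
apply/setP => z; rewrite in_setC; apply/idP/idP => [zS|].
  apply: contra (half_tree_out xy) => zS'; move: zS zS'; rewrite !mem_half_tree => xz yz.
  apply: connect_trans yz _.
  by rewrite (eq_connect (cutC x y)) (sym_connect_sym (cut_sym y x)).
suff : z \in half_tree x y :|: half_tree y x by rewrite in_setU => /orP[->|].
rewrite (@half_tree_closed (half_tree x y :|: half_tree y x)) ?inE //; last first.
  by apply/set0Pn; exists y; rewrite in_setU half_tree_id.
move=> u v uS uv; rewrite in_setU; apply: contraLR uS.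
rewrite negb_or => /andP[v1 v2].
have vu : e v u by rewrite adj_sym.
apply/negP; rewrite in_setU => /orP[/(half_tree_enter vu v1)|/(half_tree_enter vu v2)].
  by case=> vx _; rewrite vx half_tree_id in v2.
by case=> vy _; rewrite vy half_tree_id in v1.
Qed.

Lemma half_tree_ind x y (S : {set T}) : y \in S ->
  (forall u v, u \in half_tree x y -> v \in half_tree x y -> u \in S -> e u v -> v \in S) ->
  half_tree x y \subset S.
Proof.
move=> yS Scl; apply/subsetP => z; rewrite mem_half_tree => /connectP[p yp ->].
suff H u : u \in S -> u \in half_tree x y -> path (cut x y) u p -> last u p \in S.
  exact: H yS (half_tree_id x y) yp.
elim: p u {yp} => //= v p IHp u uS uH /andP[uv vp].
have vH : v \in half_tree x y.
  by move: uH; rewrite !mem_half_tree => /connect_trans; apply; apply: connect1.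
by apply: IHp => //; apply: (Scl u) => //; case/and3P: uv.
Qed.

(** The connected set [half_tree x' y'] contains no end of [xy], so it stays on the side of [y']. *)
Lemma half_tree_side x y x' y' : e x y -> x \notin half_tree x' y' ->
    y \notin half_tree x' y' ->
  (half_tree x' y' \subset half_tree x y) || (half_tree x' y' \subset ~: half_tree x y).
Proof.
have aux a b : a \notin half_tree x' y' -> b \notin half_tree x' y' ->
    y' \in half_tree a b -> half_tree x' y' \subset half_tree a b.
  move=> aN bN y'S; apply: half_tree_ind => // u v uH vH uS uv.
  apply: contraT => vS; have vu : e v u by rewrite adj_sym.
  by have [_ ub] := half_tree_enter vu vS uS; rewrite -ub uH in bN.
move=> xy xN yN; rewrite -half_treeC //.
have [y'S|y'S] := boolP (y' \in half_tree x y); first by rewrite aux.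
by rewrite (aux y x) ?orbT // half_treeC // in_setC.
Qed.

(** If [x'y'] separates [x] from [y], the two edges coincide. Otherwise one side of [x'y'] avoids
    both ends of [xy], and [half_tree_side] applies to it. *)
Lemma half_tree_cross x y x' y' : e x y -> e x' y' ->
  [|| half_tree x y \subset half_tree x' y', half_tree x' y' \subset half_tree x y,
      half_tree x y \subset ~: half_tree x' y' | ~: half_tree x' y' \subset half_tree x y].
Proof.
move=> xy xy'; have yx : e y x by rewrite adj_sym.
have [xS|xN] := boolP (x \in half_tree x' y');
  have [yS|yN] := boolP (y \in half_tree x' y').
- have := @half_tree_side x y y' x' xy.
  rewrite half_treeC // !in_setC xS yS => /(_ isT isT).
  case/orP=> [->|]; first by rewrite !orbT.
  by rewrite setCS => ->.
- by have [-> ->] := half_tree_enter yx yN xS; rewrite (half_treeC xy') subxx !orbT.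
- by have [-> ->] := half_tree_enter xy xN yS; rewrite subxx.
- case/orP: (half_tree_side xy xN yN) => [->|]; first by rewrite !orbT.
  by rewrite -setCS setCK => ->; rewrite !orbT.
Qed.

(* The edge [xy] is subdivided by the nodes [(x, y)] and [(y, x)]; a vertex
   [x] is the node [(x, x)].  Subdividing makes the sets [A r] and [B r] of a
   one-arc request distinct, which keeps the two cliques of [points_into_compl]
   disjoint. *)
Definition node := {p : T * T | (p.1 == p.2) || e p.1 p.2}.

(** For an arc [a], the wide half exceeds the narrow one by exactly the nodes [a] and [rev_arc a] on
    its edge. *)
Definition wide_half (a : T * T) : {set node} :=
  [set p | ((val p).1 \in half_tree a.1 a.2) || ((val p).2 \in half_tree a.1 a.2)].

Definition narrow_half (a : T * T) : {set node} :=
  [set p | ((val p).1 \in half_tree a.1 a.2) && ((val p).2 \in half_tree a.1 a.2)].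

Definition is_arc (a : T * T) : bool := e a.1 a.2.

Definition rev_arc (a : T * T) : T * T := (a.2, a.1).

Definition halves : {set {set node}} :=
  [set wide_half a | a in is_arc] :|: [set narrow_half a | a in is_arc].

Lemma is_arc_rev a : is_arc (rev_arc a) = is_arc a.
Proof. by rewrite /is_arc adj_sym. Qed.

Lemma wide_halfC a : is_arc a -> ~: wide_half a = narrow_half (rev_arc a).
Proof. by move=> ea; apply/setP => p; rewrite !inE negb_or /= (half_treeC ea) !in_setC. Qed.

Lemma narrow_halfC a : is_arc a -> ~: narrow_half a = wide_half (rev_arc a).
Proof. by move=> ea; apply/setP => p; rewrite !inE negb_and /= (half_treeC ea) !in_setC. Qed.

Lemma wide_in a : is_arc a -> wide_half a \in halves.
Proof. by move=> ea; rewrite inE imset_f. Qed.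

Lemma narrow_in a : is_arc a -> narrow_half a \in halves.
Proof. by move=> ea; rewrite inE imset_f ?orbT. Qed.

Lemma halvesP X : reflect
  (exists2 a, is_arc a & X = wide_half a \/ X = narrow_half a) (X \in halves).
Proof.
apply: (iffP setUP) => [[]/imsetP[a ea ->]|[a ea []->]].
- by exists a; auto.
- by exists a; auto.
- by left; apply: imset_f.
- by right; apply: imset_f.
Qed.

Lemma halves_compl X : X \in halves -> ~: X \in halves.
Proof.
by case/halvesP => a ea [] ->; rewrite ?wide_halfC ?narrow_halfC //;
   rewrite ?wide_in ?narrow_in // is_arc_rev.
Qed.

(** This is the condition of a cross-free family: it holds when the two sets do not cross. *)
Definition crossing (K : finType) (X Y : {set K}) : bool :=
  [|| X \subset Y, Y \subset X, X \subset ~: Y | ~: Y \subset X].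

Lemma crossingCr (K : finType) (X Y : {set K}) :
  crossing X (~: Y) = crossing X Y.
Proof.
rewrite /crossing setCK; case: (X \subset Y); case: (Y \subset X);
  by case: (X \subset _); case: (~: Y \subset X).
Qed.

Lemma crossingCl (K : finType) (X Y : {set K}) :
  crossing (~: X) Y = crossing X Y.
Proof.
have -> : crossing (~: X) Y = [|| ~: Y \subset X, X \subset ~: Y, Y \subset X | X \subset Y].
  rewrite /crossing !setCS; congr [|| _, _, _ | _].
    by rewrite -setCS setCK.
  by rewrite -setCS setCK.
rewrite /crossing; case: (X \subset Y); case: (Y \subset X);
  by case: (X \subset _); case: (~: Y \subset X).
Qed.

Lemma straddle a (p : node) : is_arc a -> (val p).1 \notin half_tree a.1 a.2 ->
  (val p).2 \in half_tree a.1 a.2 -> val p = a.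
Proof.
case: a p => [a b] [[x y] /= xy] ea xN yS; case/orP: xy => [/eqP xy|xy].
  by rewrite xy yS in xN.
exact: half_tree_enter xy xN yS.
Qed.

Lemma straddle_rev a (p : node) : is_arc a -> (val p).1 \in half_tree a.1 a.2 ->
  (val p).2 \notin half_tree a.1 a.2 -> val p = rev_arc a.
Proof.
move=> ea p1 p2; apply: straddle; rewrite ?is_arc_rev //= (half_treeC ea) in_setC //.
by rewrite p1.
Qed.

Lemma wide_sub a b : half_tree a.1 a.2 \subset half_tree b.1 b.2 ->
  wide_half a \subset wide_half b.
Proof.
move=> /subsetP ab; apply/subsetP => p; rewrite !inE.
by case/orP=> /ab ->; rewrite ?orbT.
Qed.

(** Widening preserves inclusions. If the half-trees are disjoint, a node common to the wide halves
    straddles both edges, so the arcs are reverse to each other; in that case the wide halves cover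
    all nodes. *)
Lemma wide_cross a b : is_arc a -> is_arc b ->
  crossing (wide_half a) (wide_half b).
Proof.
move=> ea eb; case/or4P: (half_tree_cross ea eb) => [sub|sub|/subsetP sub|/subsetP sub].
- by rewrite /crossing wide_sub.
- by rewrite /crossing (wide_sub sub) orbT.
- have [->|nab] := eqVneq a (rev_arc b).
    rewrite -narrow_halfC // crossingCl /crossing; apply/or4P/Or41/subsetP => p.
    by rewrite !inE => /andP[->].
  apply/or4P/Or43/subsetP => p; rewrite !inE negb_or.
  have bN z : z \in half_tree a.1 a.2 -> z \notin half_tree b.1 b.2.
    by move/sub; rewrite inE.
  case/orP=> pa; rewrite (bN _ pa) ?andbT //=; apply: contra nab => pb.
    have pbN := bN _ pa; rewrite -(straddle eb pbN pb).
    have paN : (val p).2 \notin half_tree a.1 a.2 by apply: contraTN pb => /bN.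
    by rewrite (straddle_rev ea pa paN) /rev_arc /= -surjective_pairing.
  have pbN := bN _ pa; have := straddle_rev eb pb pbN.
  have paN : (val p).1 \notin half_tree a.1 a.2 by apply: contraTN pb => /bN.
  by rewrite (straddle ea paN pa) => ->.
- apply/or4P/Or44/subsetP => p; rewrite !inE negb_or => /andP[pN _].
  by rewrite sub ?inE.
Qed.

Lemma halves_cross X Y : X \in halves -> Y \in halves -> crossing X Y.
Proof.
have narrowE a : is_arc a -> narrow_half a = ~: wide_half (rev_arc a).
  by move=> ea; rewrite -narrow_halfC // setCK.
case/halvesP => a ea [] -> /halvesP[b eb [] ->];
  rewrite ?narrowE ?crossingCl ?crossingCr //;
  by apply: wide_cross; rewrite ?is_arc_rev.
Qed.

Definition vertex_node (x : T) : node :=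
  exist _ (x, x) (introT orP (or_introl (eqxx x))).

(** It suffices to test vertex nodes, so subdividing leaves the interference relation unchanged. *)
Lemma narrow_sub_wide a b :
  (narrow_half a \subset wide_half b) = (half_tree a.1 a.2 \subset half_tree b.1 b.2).
Proof.
apply/subsetP/subsetP => ab x.
  by move=> xa; have := ab (vertex_node x); rewrite !inE /= orbb andbb; apply.
by rewrite !inE => /andP[/ab ->].
Qed.

Lemma narrow_wide a : narrow_half a \subset wide_half a.
Proof. by apply/subsetP => p; rewrite !inE => /andP[->]. Qed.

Lemma narrow_proper_wide a b : is_arc b -> half_tree a.1 a.2 \subset half_tree b.1 b.2 ->
  narrow_half a \proper wide_half b.
Proof.
move=> eb ab; rewrite properE narrow_sub_wide ab /=; apply/subsetPn.
have mid : (b.1 == b.2) || e b.1 b.2 by rewrite -/(is_arc b) eb orbT.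
(* The node subdividing [b] has its second coordinate in the half-tree of [b] and its first one
   outside. *)
exists (exist _ b mid : node); first by rewrite inE /= half_tree_id orbT.
by rewrite inE /= negb_and (contra (subsetP ab _) (half_tree_out eb)).
Qed.

(** The bordering node is [a] for a wide half and the vertex [a.2] for a narrow one. A half inside
    [X] containing it has [a.2] in its half-tree and [a.1] outside, hence comes from [a]. *)
Lemma halves_node X : X \in halves ->
  exists2 q, q \in X & forall Z, Z \in halves -> Z \proper X -> q \notin Z.
Proof.
case/halvesP => a ea XE.
have half_eq b : is_arc b -> half_tree b.1 b.2 \subset half_tree a.1 a.2 ->
    a.2 \in half_tree b.1 b.2 -> b = a.
  move=> eb /subsetP ba a2; have a1 : a.1 \notin half_tree b.1 b.2.
    exact: contra (ba _) (half_tree_out ea).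
  by rewrite [a]surjective_pairing (half_tree_enter ea a1 a2) -surjective_pairing.
have subX b Z : Z = wide_half b \/ Z = narrow_half b -> Z \subset X ->
    half_tree b.1 b.2 \subset half_tree a.1 a.2.
  move=> ZE ZX; rewrite -narrow_sub_wide.
  have bZ : narrow_half b \subset Z by case: ZE => ->; rewrite ?narrow_wide.
  have Xa : X \subset wide_half a by case: XE => ->; rewrite ?narrow_wide.
  exact: subset_trans (subset_trans bZ ZX) Xa.
have a1N := half_tree_out ea.
case: XE => XE; subst X.
  have mid : (a.1 == a.2) || e a.1 a.2 by rewrite -/(is_arc a) ea orbT.
  exists (exist _ a mid : node) => [|Z /halvesP[b eb ZE] ZX].
    by rewrite inE /= half_tree_id orbT.
  have ba := subX b _ ZE (proper_sub ZX).
  have a1 := contra (subsetP ba _) a1N.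
  case: ZE ZX => -> ZX; rewrite inE /= (negPf a1) //=.
  by apply/negP => /(half_eq b eb ba) bE; rewrite bE properxx in ZX.
exists (vertex_node a.2) => [|Z /halvesP[b eb ZE] ZX].
  by rewrite inE /= half_tree_id.
have ba := subX b _ ZE (proper_sub ZX).
apply/negP => qZ; have a2 : a.2 \in half_tree b.1 b.2.
  by case: ZE qZ => ->; rewrite inE /= ?orbb ?andbb.
have bE := half_eq b eb ba a2; move: ZX; rewrite {}bE in ZE *.
case: ZE => ->; rewrite ?properxx // properE => /andP[wn _].
by have := narrow_proper_wide ea (subxx _); rewrite properE wn andbF.
Qed.

(** The half-tree can only be left through [x], which is not revisited. *)
Lemma first_half_path x v q : path e x (v :: q) -> x \notin v :: q ->
  {in v :: q, forall z, z \in half_tree x v}.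
Proof.
move=> /= /andP[_ vq] xN z; have : v \in half_tree x v by apply: half_tree_id.
suff H u : path e u q -> x \notin u :: q -> u \in half_tree x v ->
    z \in u :: q -> z \in half_tree x v by move/H; apply.
elim: q u {vq xN} => [|w q IHq] u /=; first by move=> _ _ uS; rewrite inE => /eqP->.
move=> /andP[uw wq]; rewrite inE negb_or => /andP[xu xN] uS.
rewrite inE => /orP[/eqP->//|]; apply: IHq => //.
apply: contraT => wS; have wu : e w u by rewrite adj_sym.
by have [wx _] := half_tree_enter wu wS uS; rewrite wx inE eqxx in xN.
Qed.

(** The half-tree can only be entered at [t], which does not occur earlier. *)
Lemma last_half_path x q t : path e x (rcons q t) -> t \notin x :: q ->
  {in x :: q, forall z, z \notin half_tree (last x q) t}.
Proof.
elim: q x => [|y q IHq] x /=.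
  by rewrite andbT => xt _ z; rewrite inE => /eqP->; apply: half_tree_out.
move=> /andP[xy yq]; rewrite inE negb_or => /andP[tx tN].
have yN := IHq y yq tN; move=> z; rewrite inE => /orP[/eqP->|/yN//].
apply/negP => xS; have yx : e y x by rewrite adj_sym.
have [_ xt] := half_tree_enter yx (yN y (mem_head _ _)) xS.
by rewrite xt eqxx in tx.
Qed.

Lemma enter_path a b x q : path e x q -> x \notin half_tree a b ->
  last x q \in half_tree a b -> (a, b) \in pairmap pair x q.
Proof.
elim: q x => [|y q IHq] x /=; first by move=> _ /negPf->.
move=> /andP[xy yq] xN lS; rewrite inE.
have [yS|yN] := boolP (y \in half_tree a b); last by rewrite IHq ?orbT.
by rewrite (half_tree_enter xy xN yS) eqxx.
Qed.

Lemma mem_pairmap_pair (a : T * T) x q : a \in pairmap pair x q ->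
  (a.1 \in x :: q) && (a.2 \in q).
Proof.
elim: q x => //= y q IHq x; rewrite inE => /orP[/eqP->|/IHq].
  by rewrite !inE !eqxx.
by case/andP=> a1 a2; rewrite inE a1 inE a2 !orbT.
Qed.

(** Both half-trees contain [t] and miss [x], so they are nested. The opposite inclusion would put
    [v] in the last half-tree, which happens only for a one-arc path, where the two agree. *)
Lemma half_tree_dipath x v q w t q' : path e x (v :: q) -> uniq (x :: v :: q) ->
  v :: q = rcons q' t -> w = last x q' -> half_tree w t \subset half_tree x v.
Proof.
move=> xq /= /andP[xN uq] qE wE.
have tN : t \notin x :: q'.
  rewrite inE negb_or; have := xN; rewrite qE mem_rcons inE eq_sym negb_or.
  case/andP=> -> _ /=; have : uniq (v :: q) by [].
  by rewrite qE rcons_uniq => /andP[].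
have fH := first_half_path xq xN.
have xq' := xq; rewrite qE in xq'; have lH := last_half_path xq' tN.
have tq : t \in v :: q by rewrite qE mem_rcons mem_head.
have wt : e w t by move: xq'; rewrite rcons_path -wE => /andP[].
have xv : e x v by case/andP: xq.
rewrite -wE in lH; have xw := lH x (mem_head _ _).
case/or4P: (half_tree_cross xv wt) => // /subsetP sub.
- case: q' qE wE lH {tN xq' xw} => [[-> _] -> _|v' q' [<- _] _ lH].
    exact: subxx.
  by move: (lH v); rewrite !inE eqxx orbT (sub _ (half_tree_id x v)) => /(_ isT).
- by have := sub t (fH t tq); rewrite inE half_tree_id.
- by have := sub x; rewrite inE (negPf (half_tree_out xv)) => /(_ xw).
Qed.

(** Emission and reception arcs for arbitrary vertex sequences, so that they also apply to
    [tree_path]; on a single vertex [x] both are [(x, x)]. *)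
Definition first_arc (p : T * seq T) : T * T := (p.1, head p.1 p.2).

Definition last_arc (p : T * seq T) : T * T :=
  (nth p.1 (p.1 :: p.2) (size p.2).-1, last p.1 p.2).

Lemma last_arc_rcons x q t : last_arc (x, rcons q t) = (last x q, t).
Proof.
rewrite /last_arc /= last_rcons size_rcons -rcons_cons nth_rcons /= ltnS leqnn.
by rewrite (last_nth x).
Qed.

Lemma dipath_arcs (p : T * seq T) : dipath p -> 0 < size p.2 ->
  [/\ is_arc (first_arc p), is_arc (last_arc p) &
      half_tree (last_arc p).1 (last_arc p).2
        \subset half_tree (first_arc p).1 (first_arc p).2].
Proof.
case: p => x q /andP[xq uq]; rewrite /= in xq uq.
case: (lastP q) xq uq => // q' t xq uq _.
have lE := last_arc_rcons x q' t.
case qE: (rcons q' t) xq uq lE => [|v q2] xq uq lE.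
  by move/(congr1 size): qE; rewrite size_rcons.
rewrite lE; split; first by case/andP: xq.
  by move: xq; rewrite -qE rcons_path /is_arc => /andP[].
exact: half_tree_dipath xq uq (esym qE) (erefl _).
Qed.

(** * Interference as inclusion of half-trees *)

Lemma request_dipath (r : request T) : dipath r.
Proof. by case/andP: (requestP r). Qed.

Lemma request_size (r : request T) : 0 < size r.2.
Proof. by case/andP: (requestP r) => _; rewrite /arcs size_pairmap. Qed.

Lemma prefix_arc a (p : T * seq T) :
  prefix [:: a] (arcs p) = (0 < size p.2) && (a == first_arc p).
Proof. by case: p => x [|v q] //=; rewrite prefix0s andbT. Qed.

Lemma suffix_arc a (p : T * seq T) :
  suffix [:: a] (arcs p) = (0 < size p.2) && (a == last_arc p).
Proof.
case: p => x q; case: (lastP q) => [|q' t]; first by [].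
rewrite last_arc_rcons /arcs /= size_rcons /= -cats1 pairmap_cat /= cats1.
by rewrite -[[:: a]]/(rcons [::] a) suffix_rcons suffix0s andbT.
Qed.

(** Under the inclusion the source lies outside both half-trees and the target inside both, so the
    path uses both arcs. Being simple, it uses the arc leaving the source first and the arc entering
    the target last. *)
Lemma interferes_onE (r r' : request T) : interferes_on r r' =
  (narrow_half (reception_arc r') \subset wide_half (emission_arc r)).
Proof.
rewrite narrow_sub_wide /interferes_on prefix_arc suffix_arc.
have [ea _ _] := dipath_arcs (request_dipath r) (request_size r).
have /and3P[] := xchooseP (dipath_exists (source r) (target r')).
rewrite -/(tree_path _ _); case: (tree_path _ _) => x q dp /eqP xE /eqP lE.
rewrite /= in xE lE.
apply/idP/idP => [/andP[/andP[q0 /eqP->] /andP[_ /eqP->]]|/subsetP sub].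
  by have [] := dipath_arcs dp q0.
have /andP[/= xq uq] := dp.
have enter a b : x \notin half_tree a b -> last x q \in half_tree a b ->
  (a, b) \in pairmap pair x q by apply: enter_path.
have sN : x \notin half_tree (source r) (second r) by rewrite xE half_tree_out.
have tS : last x q \in half_tree (penultimate r') (target r').
  by rewrite lE half_tree_id.
have em := enter _ _ sN (sub _ tS).
have re := enter _ _ (contra (sub x) sN) tS.
apply/andP; split.
  case: q uq em {xq lE tS re enter dp} => //= v q /andP[xN _].
  rewrite inE => /orP[//|/mem_pairmap_pair/andP[]] /=.
  by rewrite -xE (negPf xN).
case: (lastP q) uq lE re {xq em tS enter dp} => // q' t.
rewrite last_arc_rcons size_rcons last_rcons /= rcons_uniq => /and3P[_ tN _] tE.
rewrite -cats1 pairmap_cat mem_cat inE => /orP[/mem_pairmap_pair/andP[_]|//].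
by rewrite -tE /= (negPf tN).
Qed.

End HalfTrees.

Theorem theorem13 (T : tree) (R : {fset request T}) :
  chromatic_number (interference_graph R)
    <= 2 * clique_number (interference_graph R).
Proof.
set G := interference_graph R; set w := clique_number G.
(* Taking wide halves for emission and narrow ones for reception makes [B r] a proper subset of
   [A r] even for a one-arc request. *)
pose A (r : G) := wide_half (emission_arc (val r)).
pose B (r : G) := narrow_half (reception_arc (val r)).
have meetsE (r r' : G) : @adj G r r' = meets A B r r'.
  rewrite /= /conflict /meets !interferes_onE; congr (_ && _).
have [/card_gt0P[x0 _]] := tree_nonempty T.
have [c [cw ce]] : set_colourable (meets A B) setT (2 * w).
  apply: (cross_free_colourable (@halves_compl T) (@halves_cross T) (@halves_node T)).
  - by move=> r; have [ea _ _] := dipath_arcs (request_dipath (val r)) (request_size (val r));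
      apply: wide_in.
  - by move=> r; have [_ eb _] := dipath_arcs (request_dipath (val r)) (request_size (val r));
      apply: narrow_in.
  - move=> r; have [ea _ sub] := dipath_arcs (request_dipath (val r)) (request_size (val r)).
    exact: narrow_proper_wide.
  - exact: vertex_node x0.
  - move=> K _ /is_cliqueP Kcl; apply: (@leq_bigmax_cond _ _ (fun A : {set G} => #|A|)).
    apply/forall_inP => x xK; apply/forall_inP => y yK; apply/implyP => xy.
    by rewrite meetsE; apply: Kcl.
rewrite /chromatic_number; case: ex_minnP => m _; apply.
apply/existsP; exists [ffun r => Ordinal (cw r (in_setT r))].
apply/forallP=> x; apply/forallP=> y; apply/implyP; rewrite meetsE => xy.
by rewrite !ffunE -val_eqE /=; apply: ce; rewrite ?in_setT.
Qed.
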